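(* The following six upper bounds hold: $n(3,11,\underline{12})\le 228$, $n(3,13,\underline{14})\le 600$, $n(3,15,\underline{16})\le 1760$, $n(4,7,\underline{8})\le 195$, $n(4,9,\underline{10})\le 972$, and $n(5,5,\underline{6})\le 128$. That is, for each $(k,g,N)\in\{(3,11,228),(3,13,600),(3,15,1760),(4,7,195),(4,9,972),(5,5,128)\}$ there exists a $k$-regular graph of girth exactly $g$ with at most $N$ vertices that contains no cycle of length $g+1$.
   Context: Graphs are finite and simple. A $(k,g)$-graph is a $k$-regular graph with girth exactly $g$. A $(k,g,\underline{g+1})$-graph is a $(k,g)$-graph containing no cycle (as a not necessarily induced subgraph) of length $g+1$, and $n(k,g,\underline{g+1})$ denotes the minimum number of vertices of such a graph. *)

(* Defs.v *)
From mathcomp Require Import all_boot.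

Set Implicit Arguments.
Unset Strict Implicit.
Unset Printing Implicit Defensive.

Record sgraph := SGraph {
  vertex :> finType;
  adj : rel vertex;
  adj_sym : symmetric adj;
  adj_irrefl : irreflexive adj
}.

Definition regular (k : nat) (G : sgraph) : Prop :=
  forall x : G, #|[set y | adj x y]| = k.

(* The bound 3 <= l discards the degenerate closed walks [::], [:: x] and
   [:: x; y] (an edge traversed back and forth) that ucycle alone allows. *)
Definition has_cycle (G : sgraph) (l : nat) : Prop :=
  3 <= l /\ exists c : seq G, size c = l /\ ucycle (@adj G) c.

Definition has_girth (G : sgraph) (g : nat) : Prop :=
  has_cycle G g /\ forall l, has_cycle G l -> g <= l.

Definition kg_graph (k g : nat) (G : sgraph) : Prop :=
  regular k G /\ has_girth G g.

(* The (k, g, \underline{g+1})-graphs. *)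
Definition kg_avoid_graph (k g : nat) (G : sgraph) : Prop :=
  kg_graph k g G /\ ~ has_cycle G g.+1.

(* n(k, g, \underline{g+1}) = n, as a relation: a minimum only makes sense when
   some such graph exists, so is_min_order also asserts existence. *)
Definition is_min_order (k g n : nat) : Prop :=
  (exists G : sgraph, kg_avoid_graph k g G /\ #|G| = n) /\
  (forall G : sgraph, kg_avoid_graph k g G -> n <= #|G|).

Definition min_order_le (k g N : nat) : Prop :=
  exists n : nat, is_min_order k g n /\ n <= N.

(* Main.v *)
Require Import Defs.
From mathcomp Require Import all_boot.
From Stdlib Require Import Classical NArith.
From mathcomp Require Import zify.

Set Implicit Arguments.
Unset Strict Implicit.
Unset Printing Implicit Defensive.

(* Each bound is witnessed by an explicit graph, found by computer search among
   the lifts of small base graphs with voltages in a group Gamma: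
     (3,11)   228 vertices,  Gamma = Z_19,
     (3,13)   600 vertices,  Gamma = (Z_5 : Z_4) x Z_5,
     (3,15)  1760 vertices,  Gamma = (Z_11 : Z_5) x Z_8,
     (4,7)    195 vertices,  Gamma = Z_39,
     (4,9)    960 vertices,  Gamma = a group of order 480,
     (5,5)    128 vertices,  Gamma = a group of order 64.
   A cyclic subgroup Z_L of Gamma acts semiregularly on the lift, so the graph is
   determined by the neighbours of one vertex in each orbit.  For g = 2h+1, girth
   at least g without (g+1)-cycles amounts to a local condition at each vertex v:
   the non-backtracking walks of length at most h from v have distinct ends, and
   so do those of length h+1.  By symmetry it is enough to check one vertex per
   orbit of Z_L. *)

(** * Preliminaries: injectivity, minimum order, list reversal *)

Lemma uniq_map_inj_in (S T : eqType) (f : S -> T) (s : seq S) :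
  uniq (map f s) -> {in s &, injective f}.
Proof.
elim: s => [|z s IHs] //= /andP[fz_s Us] x y.
rewrite !inE => /predU1P[-> | xs] /predU1P[-> | ys] // fxy.
- by rewrite fxy map_f in fz_s.
- by rewrite -fxy map_f in fz_s.
exact: IHs.
Qed.

(** Descent on the order: excluded middle either yields a strictly smaller admissible graph or shows
    that the current one is minimal. *)
Lemma min_order_le_intro k g N (G : sgraph) :
  kg_avoid_graph k g G -> #|G| <= N -> min_order_le k g N.
Proof.
move: {2}#|G| (leqnn #|G|) => n; elim: n G => [|n IHn] G leGn kgG leGN.
  exists #|G|; split=> //; split; first by exists G.
  by move=> H _; move: leGn; rewrite leqn0 => /eqP->.
have [[H [kgH ltHG]] | minG] :=
    classic (exists H : sgraph, kg_avoid_graph k g H /\ #|H| < #|G|).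
  apply: (IHn H) => //; first by rewrite -ltnS (leq_trans ltHG).
  exact: leq_trans (ltnW ltHG) leGN.
exists #|G|; split=> //; split; first by exists G.
by move=> H kgH; rewrite leqNgt; apply/negP => ltHG; apply: minG; exists H.
Qed.

(** Both sides are the entry of [s] at index [t - 1], since index [u - 1] of [rev s] is index
    [size s - u] of [s]. *)
Lemma last_take_rev (T : Type) (v : T) s t u :
    0 < t -> 0 < u -> t + u = (size s).+1 ->
  last v (take t s) = last v (take u (rev s)).
Proof.
case: t u => [|t] [|u] // _ _ Dl.
rewrite !(last_nth v) !size_takel ?size_rev /=; try lia.
rewrite !nth_take // nth_rev; last lia.
by congr nth; lia.
Qed.

(** * Non-backtracking walks and short cycles *)

Section Walks.

Variables (T : eqType) (nb : T -> seq T).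

Fixpoint nbwalks (d : nat) (p v : T) : seq (seq T) :=
  if d is d'.+1 then
    flatten [seq [seq w :: s | s <- nbwalks d' v w] | w <- nb v & w != p]
  else [:: [::]].

(* No step at all returns to [v] when [nb] is irreflexive, so taking [v] as its
   own predecessor puts no restriction on the first step. *)
Definition walk_ends (d : nat) (v : T) : seq T :=
  [seq last v s | s <- nbwalks d v v].

(** A path with distinct vertices never returns to the vertex it has just left, so every step
    survives the filter [w != p]. *)
Lemma mem_nbwalks (e : rel T) p v s :
    (forall x y, e x y -> y \in nb x) ->
  path e v s -> uniq (v :: s) -> p \notin s -> s \in nbwalks (size s) p v.
Proof.
move=> e_nb; elim: s p v => [|w s IHs] p v //= /andP[evw ews].
rewrite !inE !negb_or => /andP[/andP[_ vs] Us] /andP[pw ps].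
apply/flattenP; exists [seq w :: s' | s' <- nbwalks (size s) v w].
  by apply/map_f; rewrite mem_filter eq_sym pw e_nb.
by apply/map_f/IHs.
Qed.

Lemma take_cycle_nbwalks (e : rel T) v s t :
    (forall x y, e x y -> y \in nb x) -> ucycle e (v :: s) -> t <= size s ->
  take t s \in nbwalks t v v.
Proof.
move=> e_nb /andP[/= cyc_s /andP[vs Us]] lets.
have sub_t : {subset take t s <= s} by move=> x; apply: mem_take.
have := @mem_nbwalks e v v (take t s) e_nb; rewrite size_takel //; apply.
- by move: cyc_s; rewrite rcons_path -{1}(cat_take_drop t s) cat_path => /andP[/andP[]].
- by rewrite /= take_uniq // andbT; apply: contra vs => /sub_t.
- by apply: contra vs => /sub_t.
Qed.

(* Two walks from [v] going round the cycle in opposite directions meet at the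
   middle vertex or, for odd cycles, just beside it. *)
Lemma ucycle_collision (e : rel T) v s h :
    symmetric e -> (forall x y, e x y -> y \in nb x) ->
    ucycle e (v :: s) -> 1 < size s ->
    uniq (flatten [seq walk_ends d v | d <- iota 0 h.+1]) ->
    uniq (walk_ends h.+1 v) ->
  h.*2 < (size s).+1 /\ (size s).+1 != h.*2.+2.
Proof.
move=> e_sym e_nb cyc_s s_gt1 ball_uniq sphere_uniq.
have /andP[_ /andP[_ Us]] := cyc_s.
have cyc_r : ucycle e (v :: rev s).
  move: cyc_s; rewrite /ucycle -(rot_cycle 1 e (v :: rev s)) rot1_cons -rev_cons.
  rewrite rev_cycle (eq_cycle (fun x y => e_sym y x)) [cycle _ _]/= => /andP[-> ].
  by rewrite /= mem_rev rev_uniq.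
set t := (size s).+1./2; set u := uphalf (size s).+1.
have Dl : t + u = (size s).+1 by rewrite /t /u; lia.
have tu : t <= u <= t.+1 by rewrite /t /u; lia.
have t_gt0 : 0 < t by rewrite /t; case: (size s) s_gt1 => [|[]].
have lt_us : u <= size s by lia.
have lt_ts : t <= size s by lia.
have a_walk := take_cycle_nbwalks e_nb cyc_s lt_ts.
have b_walk : take u (rev s) \in nbwalks u v v.
  by apply: (take_cycle_nbwalks e_nb cyc_r); rewrite size_rev.
have meet : last v (take t s) = last v (take u (rev s)).
  by apply: last_take_rev; lia.
(* The two walks start with the first and the last entry of [s], which are different. *)
have differ : take t s != take u (rev s).
  apply/eqP => /(congr1 (head v)).
  rewrite -!nth0 !nth_take //.
  rewrite nth_rev; last lia.
  by move/eqP; rewrite nth_uniq //; lia.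
split.
  (* A cycle of length at most [2h] gives [t, u <= h], so both walks are counted in the ball, where
     [last v] is injective. *)
  rewrite ltnNge; apply/negP => le_h; case/eqP: differ.
  move: ball_uniq; rewrite (map_comp (map (last v)) (fun d => nbwalks d v v)) -map_flatten.
  move/uniq_map_inj_in; apply=> //.
    by apply/flattenP; exists (nbwalks t v v) => //; apply/mapP; exists t; rewrite ?mem_iota //; lia.
  by apply/flattenP; exists (nbwalks u v v) => //; apply/mapP; exists u; rewrite ?mem_iota //; lia.
apply/negP => /eqP le_h; case/eqP: differ.
have Dt : t = h.+1 by lia.
have Du : u = h.+1 by lia.
by apply: (uniq_map_inj_in sphere_uniq) => //; [rewrite -Dt | rewrite -Du].
Qed.

End Walks.

(** * Boolean certificates for graphs on an initial segment of [N] *)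

Definition distinct (s : seq N) : bool := sorted N.ltb (sort N.leb s).

(** Sorting preserves [uniq], and a strictly increasing list has no repetition; the test avoids the
    quadratic cost of [uniq]. *)
Lemma distinct_uniq s : distinct s -> uniq s.
Proof.
move=> s_lt; rewrite -(sort_uniq N.leb); apply: sorted_uniq s_lt.
  move=> y x z /N.ltb_lt xy /N.ltb_lt yz; apply/N.ltb_lt; exact: N.lt_trans yz.
by move=> x; apply: N.ltb_irrefl.
Qed.

Definition codes (n : N) : seq N := traject N.succ N0 (N.to_nat n).

Lemma codesP n x : N.ltb x n -> x \in codes n.
Proof.
move/N.ltb_lt=> ltxn; apply/trajectP; exists (N.to_nat x); first by lia.
rewrite -{1}(N2Nat.id x); elim: (N.to_nat x) => //= i <-; lia.
Qed.

Section CodedGraph.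

Variables (n : N) (k h : nat) (nb : N -> seq N) (sigma : N -> N) (base : pred N).

Definition check_neighbours (x : N) : bool :=
  [&& size (nb x) == k, uniq (nb x), x \notin nb x
    & all (fun y => N.ltb y n && (x \in nb y)) (nb x)].

(** The last clause makes iteration of [sigma] climb by one until it lands on a base vertex. *)
Definition check_shift (x : N) : bool :=
  [&& N.ltb (sigma x) n, nb (sigma x) == map sigma (nb x)
    & (sigma x == N.succ x) || base (sigma x)].

Definition check_ball (x : N) : bool :=
  distinct (flatten [seq walk_ends nb d x | d <- iota 0 h.+1]) &&
  distinct (walk_ends nb h.+1 x).

Definition code_adj : rel N := [rel x y | N.ltb x n && (y \in nb x)].

Definition check_cycle (c : seq N) : bool :=
  [&& size c == h.*2.+1, all (N.ltb^~ n) c & ucycleb code_adj c].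

(* With [==>] in place of [if], the call-by-value virtual machine would check the
   ball around every vertex. *)
Definition certified (c : seq N) : bool :=
  [&& all (fun x => [&& check_neighbours x, check_shift x
                      & if base x then check_ball x else true]) (codes n),
      distinct (map sigma (codes n)) & check_cycle c].

Variable c0 : seq N.
Hypothesis cert : certified c0.

Let Vertex := 'I_(N.to_nat n).
Let code (x : Vertex) : N := N.of_nat x.

Let code_lt x : N.ltb (code x) n.
Proof. by apply/N.ltb_lt; have := ltn_ord x; rewrite /code; lia. Qed.

Let code_inj : injective code.
Proof. by move=> x y /Nat2N.inj/val_inj. Qed.

Let code_onto c : all (N.ltb^~ n) c -> exists s : seq Vertex, map code s = c.
Proof.
elim: c => [|x c IHc] /=; first by exists [::].
case/andP=> /N.ltb_lt ltxn /IHc[s <-].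
have lt_x : N.to_nat x < N.to_nat n by lia.
by exists (Ordinal lt_x :: s); rewrite /= /code /= N2Nat.id.
Qed.

Let checks x : N.ltb x n ->
  [/\ check_neighbours x, check_shift x & base x -> check_ball x].
Proof.
move=> ltxn; case/and3P: cert => /allP/(_ x (codesP ltxn))/and3P[nbx shx ballx] _ _.
by split=> // bx; rewrite bx in ballx.
Qed.

Let nb_sym x y : N.ltb x n -> y \in nb x -> N.ltb y n /\ x \in nb y.
Proof.
by case/checks => /and4P[_ _ _ /allP nbx] _ _ /nbx/andP.
Qed.

Let code_adj_sym : symmetric code_adj.
Proof.
move=> x y; apply/idP/idP => /andP[ltn xy]; apply/andP; exact: nb_sym ltn xy.
Qed.

Let vadj : rel Vertex := fun x y => code y \in nb (code x).

Let vadjE x y : vadj x y = code_adj (code x) (code y).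
Proof. by rewrite /vadj /code_adj /= code_lt. Qed.

Let vadj_sym : symmetric vadj.
Proof. by move=> x y; rewrite !vadjE code_adj_sym. Qed.

Let vadj_irrefl : irreflexive vadj.
Proof. by move=> x; have [/and4P[_ _ /negbTE]] := checks (code_lt x). Qed.

Definition coded_graph : sgraph := SGraph vadj_sym vadj_irrefl.

Let ucycle_code (s : seq Vertex) : ucycle vadj s = ucycle code_adj (map code s).
Proof.
rewrite /ucycle map_inj_uniq // cycle_map.
by rewrite (eq_cycle (fun x y => vadjE x y)).
Qed.

Let sigma_inj x y : N.ltb x n -> N.ltb y n -> sigma x = sigma y -> x = y.
Proof.
move=> ltx lty; case/and3P: cert => _ /distinct_uniq U _.
by apply: (uniq_map_inj_in U); apply: codesP.
Qed.

(** [sigma] is injective on the vertices and carries neighbour lists to neighbour lists, so it acts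
    as an automorphism. *)
Let ucycle_sigma c :
  all (N.ltb^~ n) c -> ucycle code_adj c -> ucycle code_adj (map sigma c).
Proof.
move=> /allP ltc /andP[cyc_c Uc]; rewrite /ucycle map_inj_in_uniq ?Uc ?andbT; last first.
  by move=> x y xc yc; apply: sigma_inj; apply: ltc.
apply: (@homo_cycle_in _ _ (mem c) _ _ _ _ _ _ cyc_c); last by apply/allP.
move=> x y /= /ltc ltx _ /andP[_ xy].
have [_ /and3P[ltsx /eqP nbsx _] _] := checks ltx.
by apply/andP; split; last rewrite nbsx map_f.
Qed.

Let good_length l := h.*2 < l /\ l != h.*2.+2.

Let base_cycle x c :
  N.ltb x n -> base x -> ucycle code_adj c -> 2 < size c -> x \in c -> good_length (size c).
Proof.
move=> ltx bx cyc_c gt2 xc; have [i s Dc] := rot_to xc.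
move: cyc_c gt2; rewrite -(size_rot i) -(rot_ucycle i) Dc => cyc_c gt2.
have [_ _ /(_ bx)/andP[/distinct_uniq ball /distinct_uniq sphere]] := checks ltx.
apply: (ucycle_collision code_adj_sym _ cyc_c gt2 ball sphere).
by move=> y z /andP[].
Qed.

(* Shifting a cycle by [sigma] often enough makes it pass through a base vertex. *)
Let cycle_length c :
  all (N.ltb^~ n) c -> ucycle code_adj c -> 2 < size c -> good_length (size c).
Proof.
move=> ltc cyc_c gt2; case Dc: c => [|x c1]; first by rewrite Dc in gt2.
have: x \in c by rewrite Dc mem_head.
rewrite -Dc; have: N.to_nat n <= N.to_nat x + N.to_nat n by lia.
(* The invariant [n <= x + j] bounds the remaining shifts: each one short of a base vertex raises
   [x] by one, and [j = 0] contradicts [x < n]. *)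
move: {2}(N.to_nat n) => j; elim: j x c ltc cyc_c gt2 {Dc} => [|j IHj] x c ltc cyc_c gt2 le_j xc.
  by have /N.ltb_lt := allP ltc x xc; lia.
have ltx := allP ltc x xc; have [_ /and3P[ltsx _ step] _] := checks ltx.
have cyc_s := ucycle_sigma ltc cyc_c.
have sxc : sigma x \in map sigma c by apply: map_f.
rewrite -(size_map sigma c) in gt2 *.
case/orP: step => [/eqP Dsx | bsx]; last exact: (base_cycle ltsx bsx).
apply: (IHj (sigma x)) => //; last by rewrite Dsx; lia.
apply/allP => _ /mapP[y yc ->].
by have [_ /and3P[]] := checks (allP ltc y yc).
Qed.

(** [good_length] excludes both the lengths below [2h + 1] and the length [2h + 2]; the cycle [c0]
    shows that the girth is attained. *)
Lemma certified_kg_avoid : 0 < h -> kg_avoid_graph k h.*2.+1 coded_graph.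
Proof.
move=> h_gt0; have lenP l : has_cycle coded_graph l -> good_length l.
  case=> gt2 [s [Ds cyc_s]]; move: gt2; rewrite -Ds -(size_map code) => gt2.
  apply: cycle_length => //; last by rewrite -ucycle_code.
  by apply/allP => _ /mapP[x _ ->].
split; last by case/lenP => _ /eqP.
split.
  move=> x; have [/and4P[/eqP <- Unb _ /allP ltnb] _ _] := checks (code_lt x).
  have [|s Ds] := @code_onto (nb (code x)); first by apply/allP => y /ltnb/andP[].
  rewrite -Ds size_map -(card_uniqP _); last by rewrite -(map_inj_uniq code_inj) Ds.
  by apply: eq_card => y; rewrite inE /= /vadj -Ds mem_map.
split; last by move=> l /lenP[].
case/and3P: cert => _ _ /and3P[/eqP sz_c0 /code_onto[s Ds] cyc_c0].
split; first by lia.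
by exists s; split; [rewrite -sz_c0 -Ds size_map | rewrite ucycle_code Ds].
Qed.

End CodedGraph.

(* The vertex [i * L + t] is the [t]-th vertex of the [i]-th orbit of Z_L, and
   the [i]-th row lists the neighbours of the vertex [i * L]. *)
Definition lift_nb (L : N) (rows : seq (seq N)) (x : N) : seq N :=
  [seq (d / L * L + (d + x) mod L)%num | d <- nth [::] rows (N.to_nat (x / L))].

(** The generator of Z_L; it wraps around to the multiple of [L] that starts the orbit, which is a
    base vertex. *)
Definition lift_shift (L x : N) : N := (x / L * L + (N.succ x) mod L)%num.

Definition lift_base (L : N) : pred N := fun x => (x mod L == 0)%num.

Lemma certified_lift_min_order_le k h n L rows c :
    0 < h ->
    certified (N.of_nat n) k h (lift_nb L rows) (lift_shift L) (lift_base L) c ->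
  min_order_le k h.*2.+1 n.
Proof.
move=> h_gt0 cert; apply: (min_order_le_intro (certified_kg_avoid cert h_gt0)).
by rewrite card_ord Nat2N.id.
Qed.

(** * The six explicit graphs *)

Definition rows_3_11 : seq (seq N) :=
  [:: [:: 102; 120; 209]; [:: 186; 189; 208]; [:: 136; 203; 226];
    [:: 111; 140; 164]; [:: 83; 88; 157]; [:: 12; 60; 128]; [:: 13; 100; 172];
    [:: 54; 69; 190]; [:: 64; 90; 219]; [:: 20; 23; 132]; [:: 20; 44; 133];
    [:: 0; 40; 161]]%num.

Lemma min_order_le_3_11 : min_order_le 3 11 228.
Proof.
(* Here [h = 5] since 11 = 2 * 5 + 1, the 12 rows give 12 * 19 = 228 vertices, and the list is an
   11-cycle through vertex 0. *)
by apply: (@certified_lift_min_order_le 3 5 228 19 rows_3_11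
  [:: 0; 102; 67; 150; 52; 221; 154; 92; 80; 161; 209]%num);
  vm_compute.
Qed.

Definition rows_3_13 : seq (seq N) :=
  [:: [:: 178; 409; 587]; [:: 149; 448; 559]; [:: 131; 468; 511];
    [:: 102; 488; 522]; [:: 190; 432; 561]; [:: 78; 219; 479];
    [:: 49; 296; 431]; [:: 31; 220; 402]; [:: 2; 240; 490]; [:: 90; 260; 453];
    [:: 101; 333; 341]; [:: 140; 342; 370]; [:: 160; 333; 381];
    [:: 180; 363; 391]; [:: 124; 305; 316]; [:: 284; 295; 455];
    [:: 207; 247; 483]; [:: 219; 238; 417]; [:: 230; 277; 466];
    [:: 259; 269; 429]; [:: 11; 158; 343]; [:: 88; 129; 391];
    [:: 32; 187; 305]; [:: 52; 101; 374]; [:: 72; 170; 337];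
    [:: 49; 507; 513]; [:: 78; 552; 584]; [:: 21; 528; 572];
    [:: 99; 548; 592]; [:: 13; 536; 568]]%num.

Lemma min_order_le_3_13 : min_order_le 3 13 600.
Proof.
by apply: (@certified_lift_min_order_le 3 6 600 20 rows_3_13
  [:: 0; 178; 258; 331; 218; 359; 237; 367; 264; 184; 94; 575; 587]%num);
  vm_compute.
Qed.

Definition rows_3_15 : seq (seq N) :=
  [:: [:: 93; 371; 976]; [:: 83; 221; 1128]; [:: 131; 317; 1176];
    [:: 211; 389; 1256]; [:: 69; 315; 920]; [:: 1193; 1264; 1380];
    [:: 904; 1233; 1420]; [:: 889; 1008; 1516]; [:: 1049; 1064; 1588];
    [:: 1081; 1216; 1708]; [:: 400; 592; 695]; [:: 80; 664; 711];
    [:: 104; 784; 855]; [:: 232; 479; 808]; [:: 328; 496; 615];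
    [:: 468; 1569; 1607]; [:: 604; 1625; 1703]; [:: 684; 1335; 1689];
    [:: 788; 1385; 1455]; [:: 844; 1465; 1567]]%num.

Lemma min_order_le_3_15 : min_order_le 3 15 1760.
Proof.
by apply: (@certified_lift_min_order_le 3 7 1760 88 rows_3_15
  [:: 0; 93; 1133; 844; 1672; 1465; 573; 949; 676; 1576; 1681; 1474; 1603; 719; 976]%num);
  vm_compute.
Qed.

Definition rows_4_7 : seq (seq N) :=
  [:: [:: 71; 104; 140; 175]; [:: 7; 89; 134; 157]; [:: 13; 67; 141; 156];
    [:: 16; 61; 93; 187]; [:: 20; 77; 78; 125]]%num.

Lemma min_order_le_4_7 : min_order_le 4 7 195.
Proof.
by apply: (@certified_lift_min_order_le 4 3 195 39 rows_4_7
  [:: 0; 71; 82; 17; 49; 144; 175]%num);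
  vm_compute.
Qed.

Definition rows_4_9 : seq (seq N) :=
  [:: [:: 62; 610; 780; 913]; [:: 218; 503; 655; 911]; [:: 10; 868; 908; 942];
    [:: 399; 489; 614; 749]; [:: 353; 514; 679; 753]; [:: 478; 482; 705; 728];
    [:: 179; 702; 748; 867]; [:: 157; 509; 514; 611]; [:: 445; 581; 694; 815];
    [:: 46; 630; 820; 833]; [:: 268; 633; 671; 878]; [:: 260; 531; 559; 958];
    [:: 319; 573; 723; 893]; [:: 305; 535; 842; 843]; [:: 103; 573; 842; 927];
    [:: 416; 719; 802; 950]; [:: 81; 742; 777; 799]; [:: 376; 585; 592; 775];
    [:: 203; 662; 837; 926]; [:: 122; 534; 640; 680]; [:: 25; 87; 142; 504];
    [:: 110; 182; 187; 480]; [:: 285; 329; 474; 600]; [:: 281; 291; 339; 662];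
    [:: 211; 416; 423; 720]; [:: 14; 82; 181; 528]; [:: 234; 255; 464; 788];
    [:: 41; 241; 442; 562]; [:: 113; 194; 472; 888]; [:: 135; 162; 361; 912];
    [:: 136; 309; 386; 576]; [:: 91; 111; 164; 795]; [:: 12; 399; 425; 628];
    [:: 193; 374; 401; 765]; [:: 223; 236; 435; 875]; [:: 333; 334; 358; 955];
    [:: 68; 165; 250; 829]; [:: 25; 52; 307; 672]; [:: 23; 345; 442; 696];
    [:: 66; 266; 370; 845]]%num.

Lemma min_order_le_4_9 : min_order_le 4 9 960.
Proof.
by apply: (@certified_lift_min_order_le 4 4 960 24 rows_4_9
  [:: 0; 62; 882; 823; 230; 644; 460; 538; 610]%num);
  vm_compute.
Qed.

Definition rows_5_5 : seq (seq N) :=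
  [:: [:: 23; 29; 46; 84; 102]; [:: 38; 39; 55; 69; 93];
    [:: 1; 33; 54; 87; 124]; [:: 3; 56; 63; 73; 117]; [:: 9; 10; 23; 92; 118];
    [:: 2; 49; 58; 103; 111]; [:: 9; 18; 47; 108; 127];
    [:: 24; 25; 46; 65; 79]; [:: 11; 63; 98; 105; 123];
    [:: 31; 57; 89; 91; 122]; [:: 4; 17; 83; 85; 115];
    [:: 11; 36; 77; 79; 101]; [:: 2; 41; 70; 91; 114];
    [:: 41; 52; 71; 107; 109]; [:: 27; 34; 85; 102; 123];
    [:: 20; 49; 69; 78; 117]]%num.

Lemma min_order_le_5_5 : min_order_le 5 5 128.
Proof.
by apply: (@certified_lift_min_order_le 5 2 128 8 rows_5_5
  [:: 0; 23; 86; 81; 84]%num);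
  vm_compute.
Qed.

Theorem mainTheorem15 :
  min_order_le 3 11 228 /\
  min_order_le 3 13 600 /\
  min_order_le 3 15 1760 /\
  min_order_le 4 7 195 /\
  min_order_le 4 9 972 /\
  min_order_le 5 5 128.
Proof.
split; first exact: min_order_le_3_11.
split; first exact: min_order_le_3_13.
split; first exact: min_order_le_3_15.
split; first exact: min_order_le_4_7.
split; last exact: min_order_le_5_5.
(* The explicit graph has 960 vertices, which is better than the required 972. *)
have [n [min_n le_n]] := min_order_le_4_9.
by exists n; split; last exact: leq_trans le_n _.
Qed.
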